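(* Let $\{\bar{\mathscr{M}}(t)\}_{t\ge0}$ be the multivariate generalized counting process time-changed by an independent multivariate gamma subordinator, with parameters $q$, $k_i$, $\lambda_{ij_i}$, $\lambda$, $\theta$, $a_i$ as in the context. Then for all $\bar n=(n_1,\dots,n_q)\in\mathbb{N}_0^q$ and $t\ge0$, the state probabilities $p_{\bar{\mathscr{M}}}(\bar{n},t)=\Pr\{\bar{\mathscr{M}}(t)=\bar{n}\}$ are $$p_{\bar{\mathscr{M}}}(\bar{n},t)=(1-\theta)^{\lambda t}\sum_{h=0}^{\infty}\frac{\theta^h}{h!}(\lambda t)_h \prod_{i=1}^{q}\Big(\frac{a_i}{a_i+\lambda_i}\Big)^{h+\lambda t}\sum_{\Omega(k_i,n_i)}(h+\lambda t)_{\eta_i}\prod_{j_i=1}^{k_i}\Big(\frac{\lambda_{ij_i}}{a_i+\lambda_i}\Big)^{n_{ij_i}}\frac{1}{n_{ij_i}!},$$ where $\lambda_i=\lambda_{i1}+\dots+\lambda_{ik_i}$ and $\eta_i=n_{i1}+\dots+n_{ik_i}$ for $i=1,\dots,q$.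
   Context: Multivariate GCP: let $q\in\mathbb{N}$, $k_1,\dots,k_q\in\mathbb{N}$ and $\lambda_{ij_i}>0$ for $1\le i\le q$, $1\le j_i\le k_i$. $\bar M(t)=(M_1(t),\dots,M_q(t))$ has independent components, where $\{M_i(t)\}_{t\ge0}$ is a generalized counting process (GCP): the Lévy process started at $0$ performing independent jumps of sizes $j_i=1,\dots,k_i$ with rates $\lambda_{ij_i}$; equivalently $\Pr\{M_i(t)=n_i\}=\sum_{\Omega(k_i,n_i)}\prod_{j_i=1}^{k_i}\frac{(\lambda_{ij_i}t)^{n_{ij_i}}}{n_{ij_i}!}e^{-\lambda_{ij_i}t}$, $n_i\ge0$. Multivariate gamma subordinator: let $\lambda>0$, $0<\theta<1$, $a_1,\dots,a_q>0$. $\{Z_i(t)\}_{t\ge0}$ are gamma Lévy processes with $Z_i(t)\sim\Gamma(\lambda t,a_i)$ (shape $\lambda t$, rate $a_i$), $\{B^-(\lambda t)\}_{t\ge0}$ is a negative binomial Lévy process with $\Pr\{B^-(\lambda t)=n\}=(1-\theta)^{\lambda t}\binom{n+\lambda t-1}{n}\theta^n$, $n\ge0$, and $Z_1,\dots,Z_q,B^-$ are mutually independent. $\bar G(t)=(G_1(t),\dots,G_q(t))$ with $G_i(t)=Z_i(t+\lambda^{-1}B^-(\lambda t))$. Time-changed process: $\{\bar M(t)\}$ and $\{\bar G(t)\}$ are independent and $\bar{\mathscr{M}}(t)=(\mathscr{M}_1(t),\dots,\mathscr{M}_q(t))$ with $\mathscr{M}_i(t)=M_i(G_i(t))$. Notation: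 $\mathbb{N}_0=\{0,1,2,\dots\}$; $\Omega(k_i,n_i)=\{(n_{i1},\dots,n_{ik_i})\in\mathbb{N}_0^{k_i}:\sum_{j_i=1}^{k_i}j_in_{ij_i}=n_i\}$, and a sum over $\Omega(k_i,n_i)$ is over these tuples (so $\eta_i$ depends on the tuple); $(x)_0=1$, $(x)_k=x(x+1)\cdots(x+k-1)$ for $k\ge1$. *)

(* Defs.v *)
From HB Require Import structures.
From mathcomp Require Export all_boot all_order all_algebra.
From mathcomp Require Export all_classical all_reals all_analysis.

Set Implicit Arguments.
Unset Strict Implicit.
Unset Printing Implicit Defensive.

Import Order.TTheory GRing.Theory Num.Theory.
Import numFieldNormedType.Exports.

Local Open Scope classical_set_scope.
Local Open Scope ring_scope.

(* Processes are functions R -> Omega -> S of which only the times t >= 0 are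
   ever constrained. *)

(* For families of sigma-algebras, which all contain the whole space, the
   product rule over the full family implies it over every subfamily. *)
Definition mutually_independent (R : realType) (d : measure_display)
    (Omega : measurableType d) (P : probability Omega R)
    (I : finType) (F : I -> set (set Omega)) : Prop :=
  forall A : I -> set Omega, (forall i, F i (A i)) ->
    P [set w | forall i, A i w] = (\prod_i fine (P (A i)))%:E.

Definition independent2 (R : realType) (d : measure_display)
    (Omega : measurableType d) (P : probability Omega R)
    (F G : set (set Omega)) : Prop :=
  forall A B, F A -> G B -> P (A `&` B) = (P A * P B)%E.

(* sigma(X) *)
Definition sigma_rv (d d' : measure_display) (Omega : measurableType d)
    (S : measurableType d') (X : Omega -> S) : set (set Omega) :=
  preimage_set_system [set: Omega] X measurable.

(* sigma(X(t), t >= 0) *)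
Definition sigma_process (R : realType) (d d' : measure_display)
    (Omega : measurableType d) (S : measurableType d')
    (X : R -> Omega -> S) : set (set Omega) :=
  <<s \bigcup_(t in [set t | 0 <= t]) sigma_rv (X t) >>.

(* sigma(X_i(t), t >= 0, i in I) *)
Definition sigma_processes (R : realType) (d d' : measure_display)
    (Omega : measurableType d) (S : measurableType d') (I : Type)
    (X : I -> R -> Omega -> S) : set (set Omega) :=
  <<s \bigcup_i sigma_process (X i) >>.

Definition cadlag (R : realType) (f : R -> R) : Prop :=
  (forall t, 0 <= t -> f x @[x --> t^'+] --> f t) /\
  (forall t, 0 < t -> cvg (f x @[x --> t^'-])).

Record levy_process (R : realType) (d : measure_display)
    (Omega : measurableType d) (P : probability Omega R)
    (X : R -> Omega -> R) : Prop := LevyProcess {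
  levy_measurable : forall t, 0 <= t -> measurable_fun [set: Omega] (X t) ;
  levy_start : {ae P, forall w, X 0 w = 0} ;
  levy_independent_increments : forall (n : nat) (s : nat -> R),
    0 <= s 0%N -> (forall i, (i < n)%N -> s i <= s i.+1) ->
    mutually_independent P
      (fun i : 'I_n => sigma_rv (fun w => X (s i.+1) w - X (s i) w)) ;
  levy_stationary_increments : forall (s t : R) (A : set R),
    0 <= s -> 0 <= t -> measurable A ->
    P [set w | A (X (s + t) w - X s w)] = P [set w | A (X t w)] ;
  levy_stochastic_continuity : forall s e : R, 0 <= s -> 0 < e ->
    P [set w | e <= `|X t w - X s w|]
      @[t --> within [set t | 0 <= t] (nbhs s)] --> 0%E ;
  levy_cadlag : {ae P, forall w, cadlag (fun t => X t w)}
}.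

(* The set written Omega(k, n) in the literature. The index j : 'I_k stands for
   the jump size j + 1. *)
Definition jump_counts (k n : nat) : set {ffun 'I_k -> nat} :=
  [set m | (\sum_(j < k) j.+1 * m j)%N = n].
Arguments jump_counts : clear implicits.

(* \sum_(m \in A) is 0 by convention on infinite supports; this does not
   happen for jump_counts. *)
Lemma finite_jump_counts (k n : nat) : finite_set (jump_counts k n).
Proof.
pose g (f : {ffun 'I_k -> 'I_n.+1}) : {ffun 'I_k -> nat} :=
  [ffun j => nat_of_ord (f j)].
apply: (@sub_finite_set _ _ (g @` setT)); last first.
  exact/finite_image/finite_finset.
move=> m /= hm; have le j : (m j < n.+1)%N.
  rewrite ltnS -hm (bigD1 j) //= mulSn -addnA; exact: leq_addr.
exists [ffun j => Ordinal (le j)] => //.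
by apply/ffunP => j; rewrite !ffunE.
Qed.

(* Rising factorial (x)_k. *)
Definition pochhammer (R : realType) (x : R) (k : nat) : R :=
  \prod_(i < k) (x + i%:R).

(* Binomial coefficient with a real upper argument. *)
Definition gbinomial (R : realType) (x : R) (k : nat) : R :=
  (\prod_(i < k) (x - i%:R)) / k`!%:R.

Definition generalized_counting_process (R : realType) (d : measure_display)
    (Omega : measurableType d) (P : probability Omega R)
    (k : nat) (lam : 'I_k -> R) (M : R -> Omega -> nat) : Prop :=
  levy_process P (fun t w => (M t w)%:R) /\
  forall (t : R) (n : nat), 0 <= t ->
    P [set w | M t w = n] =
    (\sum_(m \in jump_counts k n)
       \prod_(j < k) ((lam j * t) ^+ m j / (m j)`!%:R * expR (- (lam j * t))))%:E.

Definition gamma_function (R : realType) (s : R) : R :=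
  \int[lebesgue_measure]_(x in `]0, +oo[) (x `^ (s - 1) * expR (- x)).

(* Density of the law Gamma(s, a), with shape s and rate a. *)
Definition gamma_density (R : realType) (s a x : R) : R :=
  if 0 < x
  then a `^ s / gamma_function s * x `^ (s - 1) * expR (- (a * x))
  else 0.

(* At t = 0 the shape parameter lambda * t vanishes and there is no density;
   the law of Z 0 is then fixed by levy_start. *)
Definition gamma_process (R : realType) (d : measure_display)
    (Omega : measurableType d) (P : probability Omega R)
    (lambda a : R) (Z : R -> Omega -> R) : Prop :=
  levy_process P Z /\
  forall (t : R) (A : set R), 0 < t -> measurable A ->
    P [set w | A (Z t w)] =
    (\int[lebesgue_measure]_(x in A) (gamma_density (lambda * t) a x)%:E)%E.

(* N t plays the role of B^-(lambda t). *)
Definition negative_binomial_process (R : realType) (d : measure_display)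
    (Omega : measurableType d) (P : probability Omega R)
    (lambda theta : R) (N : R -> Omega -> nat) : Prop :=
  levy_process P (fun t w => (N t w)%:R) /\
  forall (t : R) (n : nat), 0 <= t ->
    P [set w | N t w = n] =
    ((1 - theta) `^ (lambda * t) * gbinomial (n%:R + lambda * t - 1) n
       * theta ^+ n)%:E.

Definition multivariate_GCP (R : realType) (d : measure_display)
    (Omega : measurableType d) (P : probability Omega R)
    (q : nat) (k : 'I_q -> nat) (lam : forall i, 'I_(k i) -> R)
    (M : 'I_q -> R -> Omega -> nat) : Prop :=
  (forall i, generalized_counting_process P (lam i) (M i)) /\
  mutually_independent P (fun i => sigma_process (M i)).

(* G is driven by Z and B. The index None of the independent family stands for
   the process B^-(lambda t), the index Some i for Z_i. *)
Definition multivariate_gamma_subordinator (R : realType) (d : measure_display)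
    (Omega : measurableType d) (P : probability Omega R)
    (q : nat) (lambda theta : R) (a : 'I_q -> R)
    (Z : 'I_q -> R -> Omega -> R) (B : R -> Omega -> nat)
    (G : 'I_q -> R -> Omega -> R) : Prop :=
  [/\ forall i, gamma_process P lambda (a i) (Z i),
      negative_binomial_process P lambda theta (fun t => B (lambda * t)),
      mutually_independent P (fun o : option 'I_q =>
        if o is Some i then sigma_process (Z i)
        else sigma_process (fun t => B (lambda * t))) &
      forall i t w, 0 <= t ->
        G i t w = Z i (t + lambda^-1 * (B (lambda * t) w)%:R) w].

(* MM_i(t) = M_i(G_i(t)). Paths of M are cadlag and values of G are nonnegative
   only almost surely, so M_i(G_i(t)) itself need not be measurable off a null
   set; MM_i(t) is any random variable equal to it almost surely. *)
Definition time_changed (R : realType) (d : measure_display)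
    (Omega : measurableType d) (P : probability Omega R) (q : nat)
    (M : 'I_q -> R -> Omega -> nat) (G : 'I_q -> R -> Omega -> R)
    (MM : 'I_q -> R -> Omega -> nat) : Prop :=
  forall i t, 0 <= t ->
    measurable_fun [set: Omega] (MM i t) /\
    {ae P, forall w, MM i t w = M i (G i t w) w}.

(* Main.v *)
(** Replace the random times [G i t] by their upper neighbours on a finite grid
    of mesh [1 / (m + 1)]. Conditioning on the grid cells freezes the times of
    [M], so the independence of [M] and [G] turns the probability into a finite
    sum of products of GCP probabilities and probabilities of cells; partitioning
    according to the value of [B] factorizes the latter over the [Z i]. As [m]
    grows, the left-hand side converges because the paths of [M] are
    right-continuous and the grid times decrease to [G i t] from strictly above,
    while each factor converges to the integral of a GCP probability against a
    gamma density. That integral is a combination of the moments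
    [x ^ k * exp (- L x)] of the gamma law, computed from
    [Gamma (s + 1) = s * Gamma s]. *)
Require Import Defs.
From mathcomp Require Import measurable_realfun ring lra.

Set Implicit Arguments.
Unset Strict Implicit.
Unset Printing Implicit Defensive.

Import Order.TTheory GRing.Theory Num.Theory.
Import numFieldNormedType.Exports.

Local Open Scope classical_set_scope.
Local Open Scope ring_scope.

(** * The gamma integral: change of rate and recursion in the shape *)

Section gamma_integral.
Context {R : realType}.
Notation mu := (@lebesgue_measure R).

(** The pushforward of Lebesgue measure under [x -> c * x] is Lebesgue measure divided by [c], and
    this map preserves the half-line. *)
Lemma ge0_integral_itv0y_scale (c : R) (f : R -> R) : 0 < c ->
  measurable_fun setT f -> (forall x, 0 <= f x) ->
  (\int[mu]_(x in `]0%R, +oo[) (f (c * x))%:E =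
   (c^-1)%:E * \int[mu]_(x in `]0%R, +oo[) (f x)%:E)%E.
Proof.
move=> c0 mf f0.
pose phi : measurableTypeR R -> measurableTypeR R := *%R c.
have mphi : measurable_fun setT phi by exact: (@measurable_funM _ _ _ setT (cst c) id).
have mf' : measurable_fun [set: R] (EFin \o f) by exact: measurableT_comp.
pose k : {nonneg R} := NngNum (ltW (divr_gt0 ltr01 c0)).
have [nu nuE] : exists nu : {measure set (measurableTypeR R) -> \bar R},
    forall A, nu A = pushforward mu phi A.
  by unshelve refine (ex_intro _ (pushforward mu phi : {measure set _ -> \bar R}) _).
have scale A : measurable A -> pushforward mu phi A = mscale k mu A.
  move=> mA.
  pose k' : {nonneg R} := NngNum (ltW c0).
  have kk' : (k%:num * k'%:num)%R = 1 by rewrite /= mul1r mulVf// gt_eqF.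
  transitivity (mscale k (mscale k' nu) A).
    by rewrite /mscale /= muleA -EFinM kk' mul1e nuE.
  rewrite /mscale; congr (_ * _)%E; apply/esym.
  (* Uniqueness reduces the claim to half-open intervals, where the preimage of []a, b]] is []a / c,
     b / c]]. *)
  apply: (@lebesgue_measure_unique _ (mscale k' nu)) => //.
  move=> X /ocitvP[->|[[a b] /= ab ->]]; first by rewrite !measure0.
  rewrite /mscale/= nuE /pushforward.
  have -> : phi @^-1` `]a, b] = `](a / c)%R, (b / c)%R]%classic.
    apply/seteqP; split => x /=; rewrite !in_itv/= ltr_pdivrMr// ler_pdivlMr//;
    by rewrite (mulrC x).
  rewrite !lebesgue_measure_itv/= !lte_fin ltr_pM2r ?invr_gt0// ab.
  by rewrite -!EFinB -EFinM; congr EFin; field; rewrite gt_eqF.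
transitivity (\int[pushforward mu phi]_(x in `]0%R, +oo[) (f x)%:E)%E.
  rewrite (ge0_integral_pushforward mphi)//=; last first.
  - by move=> x _; rewrite lee_fin.
  - exact: measurable_funTS.
  suff -> : phi @^-1` `]0%R, +oo[ = `]0%R, +oo[%classic by [].
  by apply/seteqP; split => x /=; rewrite !in_itv/= !andbT pmulr_rgt0.
rewrite (eq_measure_integral (mscale k mu)); last by move=> A mA _; exact: scale.
rewrite ge0_integral_mscale//=; first by rewrite mul1r.
- exact: measurable_funTS.
- by move=> x _; rewrite lee_fin.
Qed.

(** Kept in the extended reals, so that the change of rate and the recursion precede any convergence
    argument; finiteness comes later from the total mass of the gamma density. *)
Definition gamma_integral (s b : R) : \bar R :=
  \int[mu]_(x in `]0%R, +oo[) (x `^ (s - 1) * expR (- (b * x)))%:E.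

Lemma measurable_gamma_integrand (s b : R) :
  measurable_fun [set: R] (fun x => x `^ (s - 1) * expR (- (b * x))).
Proof.
apply: measurable_funM; first exact: measurable_powR.
by apply: measurableT_comp => //; apply: measurableT_comp => //;
  exact: measurable_funM.
Qed.

Lemma gamma_integral_ge0 (s b : R) : (0 <= gamma_integral s b)%E.
Proof.
by apply: integral_ge0 => x _; rewrite lee_fin mulr_ge0 ?powR_ge0 ?expR_ge0.
Qed.

(** Substitute [y = b * x]: the power contributes [b ^ (1 - s)] and the differential [b ^ -1]. *)
Lemma gamma_integral_rate (s b : R) : 0 < b ->
  gamma_integral s b = ((b `^ s)^-1%:E * gamma_integral s 1)%E.
Proof.
move=> b0.
have b1 : b `^ (s - 1) != 0 by rewrite gt_eqF// powR_gt0.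
have h := @ge0_integral_itv0y_scale b _ b0 (measurable_gamma_integrand s 1)
   (fun x => mulr_ge0 (powR_ge0 _ _) (expR_ge0 _)).
rewrite -/(gamma_integral s 1) in h.
have -> : (b `^ s)^-1 = (b `^ (s - 1))^-1 * b^-1.
  rewrite -invfM; congr (_^-1).
  by rewrite powRB ?(gt_eqF b0) ?implybT// powRr1 ?ltW// divfK// gt_eqF.
rewrite EFinM -muleA -h /gamma_integral -ge0_integralZl//; last 3 first.
- apply: measurable_funTS; apply: measurableT_comp => //.
  apply: (measurableT_comp (measurable_gamma_integrand s 1)).
  exact: measurable_funM.
- by move=> x _; rewrite lee_fin mulr_ge0 ?powR_ge0 ?expR_ge0.
- by rewrite lee_fin invr_ge0 powR_ge0.
apply: eq_integral => x; rewrite inE/= in_itv/= andbT => x0.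
rewrite -EFinM; congr EFin; rewrite powRM ?ltW// mul1r.
by rewrite !mulrA mulVf// mul1r.
Qed.
Lemma continuous_powR (p x : R) : 0 < x -> {for x, continuous (fun y : R => y `^ p)}.
Proof.
move=> x0; apply: differentiable_continuous; apply/derivable1_diffP.
by have [] := is_derive1_powR p x0.
Qed.

(** Upper boundary term of the integration by parts below. For an integer [N >= s], the bound
    [exp x >= x ^ (N + 1) / (N + 1)!] makes it at most [(N + 1)! / x]. *)
Lemma cvg_powR_expRN (s : R) : 0 < s ->
  n.+2%:R `^ s * expR (- n.+2%:R) @[n --> \oo] --> (0 : R).
Proof.
move=> s0.
pose N := (Num.truncn s).+1.
have sN : s <= N%:R by rewrite ltW// truncnS_gt.
apply: (@squeeze_cvgr _ _ _ _ (cst 0) (fun n => N.+1`!%:R * n.+2%:R^-1)).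
- apply: nearW => n; rewrite /= mulr_ge0 ?powR_ge0 ?expR_ge0//=.
  rewrite expRN ler_pdivrMr ?expR_gt0//.
  apply: (@le_trans _ _ (N.+1`!%:R / n.+2%:R * (n.+2%:R ^+ N.+1 / N.+1`!%:R))).
    rewrite exprS (_ : _ * _ = n.+2%:R ^+ N); last first.
      have : N.+1`!%:R != 0 :> R by rewrite pnatr_eq0 -lt0n fact_gt0.
      have : n.+2%:R != 0 :> R by [].
      by move: (N.+1`!%:R) n.+2%:R (_ ^+ N) => c y z ? ?; field; apply/andP; split.
    by rewrite -powR_mulrn// ler_powR// ler1n.
  rewrite ler_wpM2l ?divr_ge0//.
  by rewrite (le_trans _ (expR_ge1Dxn N _))// lerDr.
- exact: cvg_cst.
- rewrite -(mulr0 (N.+1`!%:R)); apply: cvgM; first exact: cvg_cst.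
  by have := @cvg_harmonic R; rewrite -(cvg_shiftS (@harmonic R)).
Qed.

(** Integration by parts on compact intervals exhausting the half-line: the boundary terms vanish
    and monotone convergence handles both integrals. *)
Lemma gamma_integral_recS (s : R) : 0 < s ->
  gamma_integral (s + 1) 1 = (s%:E * gamma_integral s 1)%E.
Proof.
move=> s0.
(* The intervals avoid 0, where [x ^ s] need not be differentiable; the shift by 2 keeps them
   nondegenerate already at [n = 0]. *)
pose A (n : nat) : set R := `[(n.+2%:R)^-1, n.+2%:R]%classic.
have A0 n x : A n x -> 0 < x.
  rewrite /A/= in_itv/= => /andP[+ _]; apply: lt_le_trans.
  by rewrite invr_gt0.
have abn n : (n.+2%:R)^-1 < n.+2%:R :> R.
  rewrite (@lt_trans _ _ 1)// ?invf_lt1 ?ltr1n//.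
have UA : \bigcup_n A n = `]0%R, +oo[%classic.
  apply/seteqP; split => x.
    by move=> [n _ /A0]; rewrite /= in_itv/= andbT.
  rewrite /= in_itv/= andbT => x0.
  exists (maxn (Num.truncn x) (Num.truncn x^-1)) => //.
  rewrite /A/= in_itv/=; apply/andP; split.
    rewrite invf_ple ?posrE//.
    apply/ltW/(lt_trans (truncnS_gt _)); rewrite ltr_nat 2!ltnS.
    by rewrite leq_maxr.
  apply/ltW/(lt_trans (truncnS_gt _)); rewrite ltr_nat 2!ltnS.
  by rewrite leq_maxl.
have ndA : nondecreasing_seq A.
  move=> m n mn; rewrite subsetEset => x; rewrite /A/= !in_itv/= => /andP[h1 h2].
  apply/andP; split.
    by rewrite (le_trans _ h1)// lef_pV2 ?posrE// ler_nat.
  by rewrite (le_trans h2)// ler_nat.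
have mg (p : R) D : measurable_fun D (fun x => (x `^ p * expR (- x))%:E).
  apply: measurable_funTS; apply: measurableT_comp => //.
  apply: measurable_funM; first exact: measurable_powR.
  exact: measurableT_comp.
have ibp n : (\int[mu]_(x in A n) (x `^ s * expR (- x))%:E =
   (- (n.+2%:R `^ s * expR (- n.+2%:R)) +
     ((n.+2%:R)^-1 `^ s * expR (- (n.+2%:R)^-1)))%:E +
   s%:E * \int[mu]_(x in A n) (x `^ (s - 1) * expR (- x))%:E)%E.
  have cE : continuous (fun x : R => expR (- x)).
    by move=> x; apply: continuous_comp; [exact: continuousN|exact: continuous_expR].
  have dE (x : R) : is_derive x 1 (fun x : R => - expR (- x)) (expR (- x)).
    have h := is_deriveN (is_derive1_comp (is_derive_expR (- x)) (is_deriveNid x 1)).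
    by apply: (is_derive_eq h); rewrite mulrN1 opprK.
  have cA (f : R -> R) : (forall x, 0 < x -> {for x, continuous f}) ->
      {within `[(n.+2%:R)^-1, n.+2%:R], continuous f}.
    move=> cf; apply: continuous_in_subspaceT => x; rewrite inE => /(A0 n).
    exact: cf.
  have dA (f : R -> R) : (forall x, 0 < x -> derivable f x 1) ->
      derivable_oo_LRcontinuous f (n.+2%:R)^-1 n.+2%:R.
    move=> df; have cf x : 0 < x -> {for x, continuous f}.
      by move=> x0; apply: differentiable_continuous; exact/derivable1_diffP/df.
    split.
    - move=> x; rewrite in_itv/= => /andP[h _]; apply: df.
      by rewrite (lt_trans _ h)// invr_gt0.
    - by apply: cvg_at_right_filter; apply: cf; rewrite invr_gt0.
    - by apply: cvg_at_left_filter; exact: cf.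
  have in0 x : x \in `](n.+2%:R)^-1, n.+2%:R[%R -> 0 < x :> R.
    by rewrite in_itv/= => /andP[h _]; rewrite (lt_trans _ h)// invr_gt0.
  (* With [- exp (- x)] as antiderivative, the subtracted integral is minus a nonnegative one, hence
     the plus sign in [ibp]. *)
  have := @integration_by_parts R (fun x => x `^ s) (fun x => - expR (- x))
    (fun x => s * x `^ (s - 1)) (fun x => expR (- x)) _ _ (abn n).
  rewrite mulrN mulrN opprK => ->.
  - rewrite -ge0_integralZl//; last 4 first.
    + exact: measurable_itv.
    + exact: mg.
    + move=> x _; rewrite lee_fin mulr_ge0 ?powR_ge0 ?expR_ge0//.
    + by rewrite lee_fin ltW.
    congr (_ + _)%E; rewrite -[RHS]oppeK; congr (- _)%E.
    rewrite -integral_ge0N; last first.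
      by move=> x _; rewrite -EFinM lee_fin !mulr_ge0 ?powR_ge0 ?expR_ge0// ltW.
    by apply: eq_integral => x _; rewrite -EFinM -EFinN mulrN mulrA.
  - apply: cA => x x0; apply: cvgM; first exact: cvg_cst.
    exact: continuous_powR.
  - apply: dA => x x0; by have [] := is_derive1_powR s x0.
  - move=> x /in0 x0; rewrite derive1E; by have [_ ->] := is_derive1_powR s x0.
  - by apply: cA => x _; exact: cE.
  - by apply: dA => x _; have [] := dE x.
  - by move=> x _; rewrite derive1E; have [_ ->] := dE x.
have lim (p : R) : (\int[mu]_(x in A n) (x `^ p * expR (- x))%:E @[n --> \oo] -->
    gamma_integral (p + 1) 1)%E.
  have -> : gamma_integral (p + 1) 1 =
      (\int[mu]_(x in \bigcup_n A n) (x `^ p * expR (- x))%:E)%E.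
    by rewrite UA; apply: eq_integral => x _; rewrite addrK mul1r.
  apply: ge0_nondecreasing_set_cvg_integral.
  - exact: ndA.
  - by move=> n; exact: measurable_itv.
  - by move=> n; exact: mg.
  - by move=> n x _; rewrite lee_fin mulr_ge0 ?powR_ge0 ?expR_ge0.
have /cvg_lim <-// := lim s; apply/cvg_lim => //.
rewrite (eq_cvg _ _ ibp).
rewrite -[(s%:E * _)%E]add0e; apply: cvgeD.
(* The sum of the limits is defined because the boundary limit is finite, even if the gamma integral
   were infinite. *)
- exact: fin_num_adde_defr.
- rewrite (_ : 0%E = (- 0 + 0)%:E); last by rewrite oppr0 addr0.
  apply: cvg_EFin; first exact: nearW.
  apply: cvgD; first by apply: cvgN; exact: cvg_powR_expRN.
  have h0 : (@harmonic R) n.+1 @[n --> \oo] --> (0 : R).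
    by rewrite (cvg_shiftS (@harmonic R)); exact: cvg_harmonic.
  rewrite -[X in _ --> (X : R)](mul0r (expR (- 0))); apply: cvgM.
    (* The left ends are positive, so they tend to 0 within the right-hand limit of [powR_cvg0]. *)
    move/cvg_at_rightP : (powR_cvg0 s0) => /(_ (fun n => (@harmonic R) n.+1)).
    by apply; split => // n; rewrite /harmonic /= invr_gt0.
  have cE : {for 0, continuous (fun x : R => expR (- x))}.
    by apply: continuous_comp; [exact: continuousN|exact: continuous_expR].
  exact: (cvg_comp _ _ h0 cE).
- apply: cvgeZl => //.
  by have := lim (s - 1); rewrite subrK.
Qed.
End gamma_integral.

(** * Exponentially weighted moments of the gamma law *)

Section gamma_moments.
Context {R : realType}.
Notation mu := (@lebesgue_measure R).

Lemma gamma_integral_addn (s : R) (k : nat) : 0 < s ->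
  gamma_integral (s + k%:R) 1 = ((pochhammer s k)%:E * gamma_integral s 1)%E.
Proof.
move=> s0; elim: k => [|k IH]; first by rewrite /pochhammer big_ord0 addr0 mul1e.
have -> : s + k.+1%:R = (s + k%:R) + 1 by rewrite -natr1 addrA.
rewrite gamma_integral_recS; last by rewrite ltr_wpDr.
rewrite IH muleA -EFinM.
by rewrite /pochhammer big_ord_recr/= mulrC.
Qed.

Lemma integral_itv0y_gamma_density (s a : R) (f : R -> R) :
  (\int[mu]_x (f x * gamma_density s a x)%:E =
   \int[mu]_(x in `]0%R, +oo[) (f x *
     (a `^ s / gamma_function s * x `^ (s - 1) * expR (- (a * x))))%:E)%E.
Proof.
rewrite [RHS]integral_mkcond; apply: eq_integral => x _.
rewrite patchE mem_setE in_itv/= andbT /gamma_density.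
by case: ifP => //; rewrite mulr0.
Qed.

Lemma gamma_function_ge0 (s : R) : 0 <= gamma_function s.
Proof. by apply: Rintegral_ge0 => y _; rewrite mulr_ge0 ?powR_ge0 ?expR_ge0. Qed.

Lemma gamma_density_ge0 (s a x : R) : 0 <= gamma_density s a x.
Proof.
rewrite /gamma_density; case: ifP => // x0.
by rewrite !mulr_ge0 ?powR_ge0 ?expR_ge0// invr_ge0 gamma_function_ge0.
Qed.

Lemma measurable_gamma_density (s a : R) : measurable_fun setT (gamma_density s a).
Proof.
apply: measurable_fun_ifT => //.
- exact: measurable_fun_ltr.
- rewrite [X in measurable_fun _ X](_ : _ = (fun x =>
    (a `^ s / gamma_function s) * (x `^ (s - 1) * expR (- (a * x))))).
    by apply: measurable_funM => //; exact: measurable_gamma_integrand.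
  by apply/funext => x; rewrite mulrA.
Qed.

(* The total mass being 1 forces [gamma_function s], a real-valued integral
   that would be 0 if it diverged, to be the actual positive integral. *)
Lemma gamma_function_integral (s a : R) : 0 < a ->
  (\int[mu]_x (gamma_density s a x)%:E = 1)%E ->
  gamma_integral s 1 = (gamma_function s)%:E /\ gamma_function s != 0.
Proof.
move=> a0 h1.
have gE : gamma_function s = fine (gamma_integral s 1).
  by congr fine; apply: eq_integral => x _; rewrite mul1r.
have g0 : gamma_function s != 0.
  apply/eqP => g0; move: h1.
  (* Since the inverse of 0 is 0, a vanishing [gamma_function s] would make the density vanish
     everywhere. *)
  rewrite (eq_integral (cst 0%E)) ?integral0; last first.
    move=> x _; rewrite /gamma_density g0 invr0 mulr0 !mul0r.
    by case: ifP.
  by move=> /eqP; rewrite eq_sym onee_eq0.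
split=> //; move: g0; rewrite gE => g0; rewrite fineK// fin_numE.
apply/andP; split; apply/eqP => h; move: g0; rewrite h/= eqxx//.
Qed.

(** The factor [x ^ k] raises the shape to [s + k] and [exp (- L x)] raises the rate to [a + L], so
    the moment is again a gamma integral. *)
Lemma integral_gamma_density_expn (s a L : R) (k : nat) :
  0 < s -> 0 < a -> 0 <= L ->
  (\int[mu]_x (gamma_density s a x)%:E = 1)%E ->
  (\int[mu]_x (x ^+ k * expR (- (L * x)) * gamma_density s a x)%:E =
   ((a / (a + L)) `^ s * (pochhammer s k / (a + L) ^+ k))%:E)%E.
Proof.
move=> s0 a0 L0 /(gamma_function_integral a0)[gE g0].
have aL0 : 0 < a + L by rewrite ltr_wpDr.
rewrite integral_itv0y_gamma_density.
transitivity ((a `^ s / gamma_function s)%:E * gamma_integral (s + k%:R) (a + L))%E.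
  rewrite /gamma_integral -ge0_integralZl; last 4 first.
  - exact: measurable_itv.
  - apply: measurable_funTS; apply: measurableT_comp => //.
    exact: measurable_gamma_integrand.
  - by move=> x _; rewrite lee_fin mulr_ge0 ?powR_ge0 ?expR_ge0.
  - by rewrite lee_fin divr_ge0 ?powR_ge0 ?gamma_function_ge0.
  apply: eq_integral => x; rewrite inE/= in_itv/= andbT => x0.
  rewrite -EFinM; congr EFin.
  rewrite (_ : s + k%:R - 1 = (s - 1) + k%:R); last by ring.
  rewrite (@powRD _ x (s - 1) k%:R) ?(gt_eqF x0) ?implybT// powR_mulrn ?ltW//.
  rewrite mulrDl opprD expRD; ring.
rewrite gamma_integral_rate// gamma_integral_addn// gE -!EFinM; congr EFin.
have p0 : (a + L) `^ s != 0 by rewrite gt_eqF// powR_gt0.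
rewrite (@powRD _ (a + L) s k%:R) ?(gt_eqF aL0) ?implybT// powR_mulrn ?ltW//.
rewrite powRM ?invr_ge0 ?ltW// -(powR_inv1 (ltW aL0)) -powRrM mulN1r powRN.
have ? : (a + L) ^+ k != 0 by rewrite expf_neq0// gt_eqF.
by field; do ?[apply/andP; split].
Qed.
End gamma_moments.

(** * GCP probabilities and their gamma mixtures *)

Section gcp_pmf.
Context {R : realType}.
Notation mu := (@lebesgue_measure R).
Variables (k : nat) (lam : 'I_k -> R) (n : nat).
Local Notation L := (\sum_(j < k) lam j).
Local Notation eta m := (\sum_(j < k) (m : {ffun 'I_k -> nat}) j)%N.
Local Notation C m :=
  (\prod_(j < k) (lam j ^+ (m : {ffun 'I_k -> nat}) j / (m j)`!%:R)).
Local Notation J := (finmap.enum_fset (fset_set (jump_counts k n))).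

Definition gcp_pmf (x : R) : R :=
  \sum_(m \in jump_counts k n)
    \prod_(j < k) ((lam j * x) ^+ m j / (m j)`!%:R * expR (- (lam j * x))).

(** The law of the counting process at an independent [Gamma(s, a)] time, as
    [integral_gcp_pmf_gamma_density] shows for [s > 0]. *)
Definition gcp_gamma_pmf (s a : R) : R :=
  (a / (a + L)) `^ s * \sum_(m \in jump_counts k n) (pochhammer s (eta m) *
    \prod_(j < k) ((lam j / (a + L)) ^+ m j / (m j)`!%:R)).

(** Collecting the powers and exponentials isolates the time variable: a finite combination of the
    functions whose gamma moments are known. *)
Lemma gcp_pmfE (x : R) :
  gcp_pmf x = \sum_(m <- J) C m * (x ^+ eta m * expR (- (L * x))).
Proof.
rewrite /gcp_pmf fsbig_finite; last exact: finite_jump_counts.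
apply: eq_bigr => m _.
rewrite -prodrXr mulr_suml -sumrN expR_sum -!big_split /=.
by apply: eq_bigr => j _; rewrite exprMn; ring.
Qed.

Lemma gcp_gamma_pmfE (s a : R) : gcp_gamma_pmf s a = \sum_(m <- J)
  C m * ((a / (a + L)) `^ s * (pochhammer s (eta m) / (a + L) ^+ eta m)).
Proof.
rewrite /gcp_gamma_pmf fsbig_finite; last exact: finite_jump_counts.
rewrite big_distrr/=; apply: eq_bigr => m _.
have -> : \prod_(j < k) ((lam j / (a + L)) ^+ m j / (m j)`!%:R) =
    C m / (a + L) ^+ eta m.
  rewrite -exprVn -prodrXr -big_split/=; apply: eq_bigr => j _.
  by rewrite exprMn mulrAC.
ring.
Qed.

Lemma continuous_gcp_pmf : continuous gcp_pmf.
Proof.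
rewrite (_ : gcp_pmf = fun x => \sum_(m <- J) C m * (x ^+ eta m * expR (- (L * x)))).
  move=> x; apply: cvg_big => //.
    exact: add_continuous.
  move=> m _; apply: cvgM; first exact: cvg_cst.
  apply: cvgM; first exact: exprn_continuous.
  apply: (@continuous_comp _ _ _ (fun x : R => - (L * x)) expR).
    by apply: continuousN; apply: cvgM; [exact: cvg_cst|exact: cvg_id].
  exact: continuous_expR.
by apply/funext => x; exact: gcp_pmfE.
Qed.

(** At shape 0 the gamma variable is the constant 0 and has no density. The two sides agree because
    [pochhammer 0 l] and [0 ^+ l] are both 1 for [l = 0] and 0 otherwise. *)
Lemma gcp_gamma_pmf0 (a : R) : gcp_gamma_pmf 0 a = gcp_pmf 0.
Proof.
rewrite gcp_pmfE gcp_gamma_pmfE; apply: eq_bigr => m _.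
rewrite powRr0 mul1r mulr0 oppr0 expR0 mulr1; congr (_ * _).
case: (eta m) => [|l]; first by rewrite /pochhammer big_ord0 expr0 divr1.
by rewrite /pochhammer big_ord_recl/= add0r !mul0r expr0n.
Qed.

Lemma integral_gcp_pmf_gamma_density (s a : R) :
  (forall j, 0 <= lam j) -> 0 < s -> 0 < a ->
  (\int[mu]_x (gamma_density s a x)%:E = 1)%E ->
  (\int[mu]_x (gcp_pmf x * gamma_density s a x)%:E = (gcp_gamma_pmf s a)%:E)%E.
Proof.
move=> lam0 s0 a0 h1.
have L0 : 0 <= L by exact: sumr_ge0.
have C0 m : 0 <= C m by apply: prodr_ge0 => j _; rewrite divr_ge0// exprn_ge0.
(* The power may be negative for [x < 0], but the density vanishes there. *)
have g0 m x : 0 <= x ^+ eta m * expR (- (L * x)) * gamma_density s a x.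
  have [x0|x0] := ltP 0 x.
    by rewrite !mulr_ge0 ?expR_ge0 ?gamma_density_ge0// exprn_ge0// ltW.
  by rewrite /gamma_density ltNge x0 mulr0.
have mg (m : {ffun 'I_k -> nat}) : measurable_fun setT
    (fun x : R => x ^+ eta m * expR (- (L * x)) * gamma_density s a x).
  apply: measurable_funM; last exact: measurable_gamma_density.
  apply: measurable_funM => //; apply: measurableT_comp => //.
  by apply: measurableT_comp => //; exact: measurable_funM.
transitivity (\int[mu]_x (\sum_(m <- J) (C m *
   (x ^+ eta m * expR (- (L * x)) * gamma_density s a x))%:E))%E.
  apply: eq_integral => x _; rewrite gcp_pmfE sumEFin; congr EFin.
  by rewrite mulr_suml; apply: eq_bigr => m _; ring.
rewrite ge0_integral_sum//; last 2 first.
- move=> m; apply: measurableT_comp => //; apply: measurable_funM => //.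
  exact: mg.
- by move=> m x _; rewrite lee_fin mulr_ge0.
rewrite gcp_gamma_pmfE -sumEFin; apply: eq_bigr => m _.
under eq_integral do rewrite EFinM.
rewrite ge0_integralZl//.
- by rewrite integral_gamma_density_expn.
- by apply: measurableT_comp => //; exact: mg.
- by move=> x _; rewrite lee_fin.
- by rewrite lee_fin.
Qed.
End gcp_pmf.

(** * Approximation of times from above by a finite grid *)

Section grid.
Context {R : realType}.

(** The cap leaves finitely many cells. The last one starts at time [m + 1], so the horizon grows
    while the mesh [1 / (m + 1)] shrinks. Negative reals fall in cell 0. *)
Definition grid_level (m : nat) (x : R) : nat :=
  minn (Num.truncn (m.+1%:R * x)) (m.+1 ^ 2).

(** The successor selects the upper end of cell [l], which lies strictly above every time in an
    uncapped cell. *)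
Definition grid_point (m l : nat) : R := l.+1%:R / m.+1%:R.

Definition grid_up (m : nat) (x : R) : R := grid_point m (grid_level m x).

Lemma grid_level_lt (m : nat) (x : R) : (grid_level m x < (m.+1 ^ 2).+1)%N.
Proof. by rewrite ltnS geq_minr. Qed.

Lemma grid_point_ge0 (m l : nat) : 0 <= grid_point m l.
Proof. by rewrite divr_ge0. Qed.

(** The times of level at least [j] form the whole line, a half-line or the empty set, and a cell is
    a difference of two such sets. *)
Lemma measurable_grid_level (m l : nat) :
  measurable [set x : R | grid_level m x = l].
Proof.
have mge j : measurable [set x : R | (j <= grid_level m x)%N].
  case: j => [|j].
    by rewrite (_ : mkset _ = setT)//; apply/seteqP; split.
  have [jm|jm] := leqP j.+1 (m.+1 ^ 2).
    rewrite (_ : mkset _ = `[j.+1%:R / m.+1%:R, +oo[%classic).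
      exact: measurable_itv.
    apply/seteqP; split => x /=;
      by rewrite leq_min jm andbT truncn_gt_nat in_itv/= andbT ler_pdivrMr// mulrC.
  rewrite (_ : mkset _ = set0)//; apply/seteqP; split => x //=.
  by rewrite leq_min [(_ <= m.+1 ^ 2)%N]leqNgt jm andbF.
rewrite (_ : mkset _ = [set x | (l <= grid_level m x)%N] `\`
                       [set x | (l.+1 <= grid_level m x)%N]).
  exact: measurableD.
apply/seteqP; split => x /=; first by move=> ->; rewrite leqnn ltnn.
by move=> [h1 /negP]; rewrite -leqNgt => h2; apply/eqP; rewrite eqn_leq h1 h2.
Qed.

Lemma grid_up_bounds (m : nat) (x : R) : 0 <= x <= m.+1%:R ->
  x < grid_up m x <= x + m.+1%:R^-1.
Proof.
move=> /andP[x0 xm]; rewrite /grid_up /grid_point /grid_level.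
have y0 : 0 <= m.+1%:R * x by rewrite mulr_ge0.
(* Up to time [m + 1] the cap is inactive. *)
have /minn_idPl -> : (Num.truncn (m.+1%:R * x) <= m.+1 ^ 2)%N.
  rewrite -(ler_nat R) (le_trans (_ : _ <= m.+1%:R * x))//.
    by rewrite truncn_le.
  by rewrite natrX expr2 ler_wpM2l.
rewrite ltr_pdivlMr// mulrC truncnS_gt/=.
by rewrite ler_pdivrMr// mulrDl mulVf// -[in leLHS]natr1 lerD2r (mulrC x) truncn_le.
Qed.

(** The strict bound of [grid_up_bounds] gives convergence along [x^'+], the form that
    right-continuity of the paths requires. *)
Lemma cvg_grid_up (x : R) : 0 <= x -> grid_up m x @[m --> \oo] --> x^'+.
Proof.
move=> x0.
have xm : \forall m \near \oo, x < grid_up m x <= x + m.+1%:R^-1.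
  exists (Num.truncn x) => // m /= mx; apply: grid_up_bounds; rewrite x0/= ltW//.
  by rewrite (lt_le_trans (truncnS_gt _))// ler_nat ltnS.
have cx : grid_up m x @[m --> \oo] --> x.
  apply: (@squeeze_cvgr _ _ _ _ (cst x) (fun m => x + m.+1%:R^-1)).
  - by apply: filterS xm => m /= /andP[/ltW -> ->].
  - exact: cvg_cst.
  - rewrite -[X in _ --> X]addr0; apply: cvgD; first exact: cvg_cst.
    exact: cvg_harmonic.
move=> A /= /cx hA; rewrite nbhs_simpl/=.
apply: filterS2 xm hA => m /andP[h _]; exact.
Qed.

(** Only the cell of [x] contributes; integrating the indicators later yields cell probabilities. *)
Lemma grid_up_sum (m : nat) (f : R -> R) (x : R) :
  f (grid_up m x) = \sum_(l < (m.+1 ^ 2).+1)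
    f (grid_point m l) * (grid_level m x == l)%:R.
Proof.
rewrite (bigD1 (Ordinal (grid_level_lt m x)))//= eqxx mulr1 big1 ?addr0// => l.
rewrite -val_eqE /= eq_sym => /negbTE ->.
by rewrite mulr0.
Qed.

End grid.

(** * Limits of series and of probabilities *)

Section limits.
Context {R : realType}.

(** Dominated convergence for the counting measure, with [b] as dominating sequence. *)
Lemma cvg_nneseries_dominated (b : nat -> R) (c : nat -> nat -> R) (c' : nat -> R) :
  (forall h, 0 <= b h) -> (\sum_(0 <= h <oo) (b h)%:E < +oo)%E ->
  (forall m h, 0 <= c m h <= 1) ->
  (forall h, c m h @[m --> \oo] --> c' h) ->
  (\sum_(0 <= h <oo) (b h * c m h)%:E @[m --> \oo] -->
   \sum_(0 <= h <oo) (b h * c' h)%:E)%E.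
Proof.
move=> b0 bfin c01 cc.
have c'0 h : 0 <= c' h.
  rewrite -(cvg_lim _ (cc h))//; apply: limr_ge; first exact: cvgP (cc h).
  by apply: nearW => m; case/andP: (c01 m h).
have term_ge0 m h : (0 <= (b h * c m h)%:E)%E.
  by rewrite lee_fin mulr_ge0//; case/andP: (c01 m h).
under eq_cvg => m do rewrite -ge0_integral_count//.
rewrite -ge0_integral_count; last by move=> h; rewrite lee_fin mulr_ge0.
have [] // := @dominated_convergence _ nat R counting setT measurableT
  (fun m h => (b h * c m h)%:E) (fun h => (b h * c' h)%:E) (EFin \o b).
- by apply: aeW => h _; apply: cvg_EFin; [exact: nearW|apply: cvgM => //; exact: cvg_cst].
- apply/integrableP; split => //.
  under eq_integral do rewrite /= ger0_norm//.
  by rewrite ge0_integral_count.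
- apply: aeW => h m _ /=; have /andP[c0 c1] := c01 m h.
  by rewrite lee_fin ger0_norm ?mulr_ge0// ler_piMr.
Qed.

(** Dominated convergence for indicators, bounded by the constant 1. *)
Lemma cvg_measure_ae d (T : measurableType d) (P : probability T R)
  (E_ : nat -> set T) (E : set T) :
  (forall m, measurable (E_ m)) -> measurable E ->
  {ae P, forall w, \forall m \near \oo, E_ m w <-> E w} ->
  P (E_ m) @[m --> \oo] --> P E.
Proof.
move=> mE_ mE ae.
have := @dominated_convergence _ _ _ P setT measurableT
  (fun m w => (\1_(E_ m) w)%:E) (fun w => (\1_E w)%:E) (cst 1%E).
case.
- move=> m; apply: measurableT_comp => //; exact: measurable_indic.
- apply: measurableT_comp => //; exact: measurable_indic.
- apply: filterS ae => w hw _; apply: cvg_near_cst.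
  apply: filterS hw => m [h1 h2]; congr EFin; rewrite !indicE.
  by congr (nat_of_bool _)%:R; apply/idP/idP; rewrite !inE.
- exact: finite_measure_integrable_cst.
- apply: aeW => w m _ /=; rewrite lee_fin indicE; by case: (_ \in _); rewrite ?normr0 ?normr1.
move=> _ _; under eq_fun do rewrite integral_indic// setIT.
by rewrite integral_indic// setIT.
Qed.
End limits.

(** * Partitions of events and generated sigma-algebras *)

Section probability_tools.
Context {R : realType} {d : measure_display} {Omega : measurableType d}.
Variable P : probability Omega R.

Lemma measure_ae_eq (A B : set Omega) : measurable A -> measurable B ->
  {ae P, forall w, A w <-> B w} -> P A = P B.
Proof.
move=> mA mB AB; rewrite -(setIT A) -(setIT B) -!integral_indic//.
apply: ae_eq_integral => //.
- apply: measurableT_comp => //; exact: measurable_indic.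
- apply: measurableT_comp => //; exact: measurable_indic.
- apply: filterS AB => w [h1 h2] _; congr EFin; rewrite !indicE.
  by congr (nat_of_bool _)%:R; apply/idP/idP; rewrite !inE.
Qed.

Lemma measure_fin_partition (I : finType) (X : Omega -> I) (A : set Omega) :
  (forall i, measurable (A `&` [set w | X w = i])) ->
  P A = (\sum_i P (A `&` [set w | X w = i]))%E.
Proof.
move=> mX; rewrite {1}(_ : A = \bigcup_(i in [set: I]) (A `&` [set w | X w = i])).
  rewrite measure_fin_bigcup//; last 2 first.
  - exact: finite_finset.
  - by move=> i j _ _ [w [[_ <-] [_ <-]]].
  rewrite (_ : setT = [set` index_enum I]).
    by rewrite -fsbig_seq// index_enum_uniq.
  by apply/seteqP; split => i //= _; exact: mem_index_enum.
apply/seteqP; split => w; first by move=> Aw; exists (X w).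
by move=> [i _ []].
Qed.

Lemma measure_nat_partition (X : Omega -> nat) (A : set Omega) :
  (forall i, measurable (A `&` [set w | X w = i])) ->
  P A = (\sum_(0 <= i <oo) P (A `&` [set w | X w = i]))%E.
Proof.
move=> mX; rewrite {1}(_ : A = \bigcup_i (A `&` [set w | X w = i])).
  rewrite measure_semi_bigcup//.
  - by move=> i j _ _ [w [[_ <-] [_ <-]]].
  - by apply: bigcup_measurable.
apply/seteqP; split => w; first by move=> Aw; exists (X w).
by move=> [i _ []].
Qed.

Lemma sigma_algebra_forall (I : finType) (S : set (set Omega)) (A : I -> set Omega) :
  (forall i, <<s S >> (A i)) -> <<s S >> [set w | forall i, A i w].
Proof.
move=> SA.
have -> : [set w | forall i, A i w] = \bigcap_(i in [set: I]) A i.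
  by apply/seteqP; split => w h i; [move=> _; exact: h|exact: h].
apply: (@fin_bigcap_measurable _ (g_sigma_algebraType S) I setT A) => [|i _].
  exact: finite_finset.
exact: SA.
Qed.

Lemma sigma_process_preimage (d' : measure_display) (S : measurableType d')
    (X : R -> Omega -> S) (t : R) (A : set S) :
  0 <= t -> measurable A -> sigma_process X [set w | A (X t w)].
Proof.
move=> t0 mA; apply: sub_sigma_algebra; exists t => //.
by exists A => //; rewrite setTI.
Qed.

Lemma sigma_processes_preimage (d' : measure_display) (S : measurableType d')
    (I : Type) (X : I -> R -> Omega -> S) (i : I) (t : R) (A : set S) :
  0 <= t -> measurable A -> sigma_processes X [set w | A (X i t w)].
Proof.
move=> t0 mA; apply: sub_sigma_algebra; exists i => //.
exact: (sigma_process_preimage (X := X i)).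
Qed.

Lemma levy_measurable_preimage (X : R -> Omega -> R) (t : R) (A : set R) :
  levy_process P X -> 0 <= t -> measurable A -> measurable [set w | A (X t w)].
Proof.
move=> hX t0 mA; rewrite -[X in measurable X]setTI.
exact: (levy_measurable hX t0).
Qed.

Lemma levy_measurable_eq_nat (N : R -> Omega -> nat) (t : R) (n : nat) :
  levy_process P (fun t w => (N t w)%:R) -> 0 <= t ->
  measurable [set w | N t w = n].
Proof.
move=> hN t0.
rewrite (_ : mkset _ = [set w | [set n%:R : R] ((N t w)%:R)]).
  exact: (levy_measurable_preimage hN t0).
apply/seteqP; split => w /=; first by move=> ->.
by move/eqP; rewrite eqr_nat => /eqP.
Qed.

Lemma prod_option (I : finType) (F : option I -> R) :
  \prod_o F o = F None * \prod_i F (Some i).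
Proof.
rewrite (bigD1 None)//=; congr (_ * _).
rewrite (reindex_omap Some id)/=; last by case.
by apply: eq_bigl => i; rewrite eqxx.
Qed.

(** Integers at distance less than 1 coincide. *)
Lemma cvg_nat_near (u : nat -> nat) (l : nat) :
  (u m)%:R @[m --> \oo] --> (l%:R : R) -> \forall m \near \oo, u m = l.
Proof.
move=> /cvgrPdist_lt /(_ 1 ltr01); apply: filterS => m.
rewrite ltr_distl ltrBlDr !natr1 !ltr_nat !ltnS => /andP[h1 h2].
by apply/eqP; rewrite eqn_leq h1 h2.
Qed.
End probability_tools.

(** * Grid sums against a density *)

Section gamma_grid.
Context {R : realType}.
Notation mu := (@lebesgue_measure R).

(** Each sum is the integral of [p (grid_up m x) * g x], which is dominated by [g] and converges
    pointwise. *)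
Lemma cvg_sum_grid_density (g p : R -> R) :
  measurable_fun setT g -> (forall x, 0 <= g x) -> (forall x, x < 0 -> g x = 0) ->
  (\int[mu]_x (g x)%:E < +oo)%E ->
  continuous p -> (forall x, 0 <= x -> 0 <= p x <= 1) ->
  (\sum_(l < (m.+1 ^ 2).+1) ((p (grid_point m l))%:E *
      \int[mu]_(x in [set x | grid_level m x = l]) (g x)%:E)
    @[m --> \oo] --> \int[mu]_x (p x * g x)%:E)%E.
Proof.
move=> mg g0 gneg gfin cp p01.
have mp : measurable_fun setT p by exact: continuous_measurable_fun.
have p0 x : 0 <= x -> 0 <= p x by move=> /p01/andP[].
pose f m l x := p (grid_point m l) * (grid_level m x == l)%:R * g x.
have mf m l : measurable_fun setT (f m l).
  apply: measurable_funM => //; apply: measurable_funM => //.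
  rewrite (_ : (fun x => _) = \1_[set x : R | grid_level m x = l] :> (R -> R)).
    by apply: measurable_indic; exact: measurable_grid_level.
  apply/funext => x; rewrite indicE; congr (nat_of_bool _)%:R.
  by apply/eqP/idP; rewrite inE.
have f0 m l x : 0 <= f m l x.
  by rewrite !mulr_ge0// p0// grid_point_ge0.
have fE m x : p (grid_up m x) * g x = \sum_(l < (m.+1 ^ 2).+1) f m l x.
  by rewrite grid_up_sum mulr_suml.
have sumE m : (\sum_(l < (m.+1 ^ 2).+1) ((p (grid_point m l))%:E *
      \int[mu]_(x in [set x | grid_level m x = l]) (g x)%:E) =
    \int[mu]_x (p (grid_up m x) * g x)%:E)%E.
  under [RHS]eq_integral => x _ do rewrite fE -sumEFin.
  rewrite ge0_integral_sum//; last 2 first.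
  - by move=> l; apply: measurableT_comp => //; exact: mf.
  - by move=> l x _; rewrite lee_fin.
  apply: eq_bigr => l _; rewrite -ge0_integralZl//; last 4 first.
  - exact: measurable_grid_level.
  - by apply: measurable_funTS; exact: measurableT_comp.
  - by move=> x _; rewrite lee_fin.
  - by rewrite lee_fin p0// grid_point_ge0.
  rewrite integral_mkcond; apply: eq_integral => x _; rewrite patchE.
  rewrite /f; have [h|h] := eqVneq (grid_level m x) l.
    by rewrite mem_set// mulr1 EFinM.
  by rewrite memNset ?mulr0 ?mul0r//; apply/eqP.
rewrite (eq_cvg _ _ sumE).
have [] // := @dominated_convergence _ _ R mu setT measurableT
  (fun m x => (p (grid_up m x) * g x)%:E) (fun x => (p x * g x)%:E) (EFin \o g).
- move=> m; apply: measurableT_comp => //.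
  under eq_fun do rewrite fE.
  by apply: measurable_sum => l; exact: mf.
- by apply: measurableT_comp => //; exact: measurable_funM.
- apply: aeW => x _; apply: cvg_EFin; first exact: nearW.
  (* Grid times are nonnegative and cannot approach a negative [x], but [g] vanishes there. *)
  have [x0|x0] := leP 0 x; last first.
    rewrite gneg// mulr0; apply: cvg_near_cst; apply: nearW => m /=.
    by rewrite mulr0.
  apply: cvgM; last exact: cvg_cst.
  have pr : p y @[y --> x^'+] --> p x by apply: cvg_at_right_filter; exact: cp.
  exact: (cvg_comp _ _ (cvg_grid_up x0) pr).
- apply/integrableP; split; first exact: measurableT_comp.
  by under eq_integral do rewrite /= ger0_norm//.
- apply: aeW => x m _ /=.
  have /andP[h0 h1] := p01 _ (grid_point_ge0 m (grid_level m x)).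
  by rewrite lee_fin ger0_norm ?mulr_ge0// ler_piMl.
Qed.
End gamma_grid.

(** * Gamma processes at a fixed time *)

Section gamma_process.
Context {R : realType} {d : measure_display} {Omega : measurableType d}.
Variable P : probability Omega R.
Notation mu := (@lebesgue_measure R).
Variables (lambda a : R) (Z : R -> Omega -> R).
Hypothesis hZ : gamma_process P lambda a Z.

Lemma gamma_process_total (u : R) : 0 < u ->
  (\int[mu]_x (gamma_density (lambda * u) a x)%:E = 1)%E.
Proof.
move=> u0; rewrite -(proj2 hZ u setT u0 measurableT).
by rewrite -[RHS](probability_setT P); congr (P _); apply/seteqP; split.
Qed.

Lemma gamma_process_ge0 (u : R) : 0 <= u -> {ae P, forall w, 0 <= Z u w}.
Proof.
rewrite le_eqVlt => /predU1P[<-|u0].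
  by apply: filterS (levy_start (proj1 hZ)) => w ->.
have mA : measurable [set w | `]-oo, 0[%classic (Z u w)].
  by apply: (levy_measurable_preimage (proj1 hZ)) => //; exact: ltW.
exists [set w | `]-oo, 0[%classic (Z u w)]; split => //.
  have /= -> := proj2 hZ u `]-oo, 0[%classic u0 (measurable_itv _).
  rewrite (eq_integral (cst 0%E)) ?integral0// => x.
  by rewrite inE/= in_itv/= /gamma_density => x0; rewrite ltNge (ltW x0).
by move=> w /= /negP; rewrite -ltNge in_itv.
Qed.

(** Here [c] is the mean of [p] under the law of [Z u]: a density for [u > 0], the point mass at 0
    for [u = 0], hence the two hypotheses on [c]. *)
Lemma cvg_sum_grid_gamma_process (p : R -> R) (c u : R) : 0 <= u ->
  continuous p -> (forall x, 0 <= x -> 0 <= p x <= 1) ->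
  (0 < u -> (\int[mu]_x (p x * gamma_density (lambda * u) a x)%:E = c%:E)%E) ->
  (u = 0 -> p 0 = c) ->
  \sum_(l < (m.+1 ^ 2).+1)
     p (grid_point m l) * fine (P [set w | grid_level m (Z u w) = l])
    @[m --> \oo] --> c.
Proof.
move=> u0 cp p01 hc c0.
have mZ m l : measurable [set w | grid_level m (Z u w) = l].
  exact: (levy_measurable_preimage (proj1 hZ) u0 (measurable_grid_level m l)).
move: u0; rewrite le_eqVlt => /predU1P[u0|u0].
  (* As [Z 0] is almost surely 0, only the cell of 0 carries mass. *)
  have h m : \sum_(l < (m.+1 ^ 2).+1)
      p (grid_point m l) * fine (P [set w | grid_level m (Z u w) = l]) =
      p (grid_up m 0).
    rewrite grid_up_sum; apply: eq_bigr => l _; congr (_ * _).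
    rewrite (@measure_ae_eq _ _ _ P _ [set _ : Omega | grid_level m (0 : R) = l])//.
    - have [h|h] := eqVneq (grid_level m (0 : R)) l.
        by rewrite (_ : mkset _ = setT) ?probability_setT//; apply/seteqP; split.
      rewrite (_ : mkset _ = set0) ?measure0//; apply/seteqP; split => // w /= /eqP.
      by rewrite (negbTE h).
    - have [h|h] := eqVneq (grid_level m (0 : R)) l.
        by rewrite (_ : mkset _ = setT)//; apply/seteqP; split.
      rewrite (_ : mkset _ = set0)//; apply/seteqP; split => // w /= /eqP.
      by rewrite (negbTE h).
    - by apply: filterS (levy_start (proj1 hZ)) => w /=; rewrite -u0 => ->.
  rewrite (eq_cvg _ _ h) -c0//.
  have pr : p y @[y --> 0^'+] --> p 0 by apply: cvg_at_right_filter; exact: cp.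
  exact: (cvg_comp _ _ (cvg_grid_up (lexx 0)) pr).
have := @cvg_sum_grid_density R (gamma_density (lambda * u) a) p
  (measurable_gamma_density _ _) (gamma_density_ge0 _ _) _ _ cp p01.
rewrite (hc u0) gamma_process_total// => h.
pose S m := \sum_(l < (m.+1 ^ 2).+1)
  p (grid_point m l) * fine (P [set w | grid_level m (Z u w) = l]).
have SE m : (\sum_(l < (m.+1 ^ 2).+1) ((p (grid_point m l))%:E *
      \int[mu]_(x in [set x | grid_level m x = l])
        (gamma_density (lambda * u) a x)%:E) = (S m)%:E)%E.
  rewrite -sumEFin; apply: eq_bigr => l _; rewrite EFinM fineK ?fin_num_measure//.
  by have /= -> := proj2 hZ u _ u0 (measurable_grid_level m l).
rewrite (eq_cvg _ _ SE) in h.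
suff /fine_cvg : (S m)%:E @[m --> \oo] --> c%:E by [].
apply: h; last by rewrite ltry.
by move=> x x0; rewrite /gamma_density ltNge ltW.
Qed.

End gamma_process.

(** * Conditioning on the random times *)

Section freezing.
Context {R : realType} {d : measure_display} {Omega : measurableType d}.
Variable P : probability Omega R.
Variable q : nat.

Lemma gcp_pmf_ge0 (k : nat) (lam : 'I_k -> R) (n : nat) (x : R) :
  (forall j, 0 <= lam j) -> 0 <= x -> 0 <= gcp_pmf lam n x.
Proof.
move=> lam0 x0; rewrite /gcp_pmf fsumr_ge0// => m _; apply: prodr_ge0 => j _.
by rewrite mulr_ge0 ?expR_ge0 ?divr_ge0// exprn_ge0 ?mulr_ge0.
Qed.

Lemma gcp_pmf_prob (k : nat) (lam : 'I_k -> R) (n : nat) (M : R -> Omega -> nat)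
    (x : R) : generalized_counting_process P lam M -> 0 <= x ->
  P [set w | M x w = n] = (gcp_pmf lam n x)%:E.
Proof. by move=> [_ h] x0; exact: h. Qed.

(** Where [B (lambda * t)] equals [h], each [G i t] is [Z i] at the fixed time [t + h / lambda];
    independence of [B] and the [Z i] then factorizes the probability. *)
Lemma multivariate_gamma_law (lambda theta : R) (a : 'I_q -> R)
    (Z : 'I_q -> R -> Omega -> R) (B : R -> Omega -> nat)
    (G : 'I_q -> R -> Omega -> R) (t : R) (C : 'I_q -> set R) :
  0 < lambda -> multivariate_gamma_subordinator P lambda theta a Z B G ->
  0 <= t -> (forall i, measurable (C i)) ->
  P [set w | forall i, C i (G i t w)] =
  (\sum_(0 <= h <oo) (fine (P [set w | B (lambda * t) w = h]) *
     \prod_i fine (P [set w | C i (Z i (t + lambda^-1 * h%:R) w)]))%:E)%E.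
Proof.
move=> lambda0 [hZ hB hind hG] t0 mC.
have u0 h : 0 <= t + lambda^-1 * h%:R.
  by rewrite addr_ge0// mulr_ge0// invr_ge0 ltW.
have mB h : measurable [set w | B (lambda * t) w = h].
  exact: (levy_measurable_eq_nat h (proj1 hB) t0).
pose A h (o : option 'I_q) : set Omega :=
  if o is Some i then [set w | C i (Z i (t + lambda^-1 * h%:R) w)]
  else [set w | B (lambda * t) w = h].
have AE h : [set w | forall i, C i (G i t w)] `&` [set w | B (lambda * t) w = h] =
    [set w | forall o, A h o w].
  apply/seteqP; split => w /=.
    by move=> [hC Bh] [i|//] /=; have := hC i; rewrite hG// Bh.
  move=> hA; have /= Bh := hA None; split=> // i.
  by have := hA (Some i); rewrite /= hG// Bh.
have mA h : measurable [set w | forall o, A h o w].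
  rewrite (_ : mkset _ = \bigcap_(o in [set: option 'I_q]) A h o).
    apply: fin_bigcap_measurable; first exact: finite_finset.
    move=> [i|] _ /=; last exact: mB.
    exact: (levy_measurable_preimage (proj1 (hZ i)) (u0 h) (mC i)).
  by apply/seteqP; split => w hw; [move=> o _; exact: hw|move=> o; exact: hw].
rewrite (measure_nat_partition P (X := B (lambda * t))); last by move=> h; rewrite AE.
apply: eq_eseriesr => h _; rewrite AE hind ?prod_option//.
case=> [i|] /=.
  exact: (sigma_process_preimage (X := Z i)).
exact: (sigma_process_preimage (X := fun t => B (lambda * t)) (A := [set h])).
Qed.

Lemma multivariate_GCP_joint (k : 'I_q -> nat) (lam : forall i, 'I_(k i) -> R)
    (M : 'I_q -> R -> Omega -> nat) (x : 'I_q -> R) (n : 'I_q -> nat) :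
  multivariate_GCP P lam M -> (forall i, 0 <= x i) ->
  P [set w | forall i, M i (x i) w = n i] =
  (\prod_i gcp_pmf (@lam i) (n i) (x i))%:E.
Proof.
move=> [hM hind] x0.
rewrite (hind (fun i => [set w | M i (x i) w = n i])).
  by congr EFin; apply: eq_bigr => i _; rewrite (gcp_pmf_prob _ (hM i)).
move=> i; exact: (sigma_process_preimage (X := M i) (A := [set n i])).
Qed.

(* Conditioning on the grid cell of each [G i] freezes the time of [M i]. *)
Lemma freeze_grid (k : 'I_q -> nat) (lam : forall i, 'I_(k i) -> R)
    (M : 'I_q -> R -> Omega -> nat) (G : 'I_q -> R -> Omega -> R)
    (n : 'I_q -> nat) (t : R) (m : nat) :
  multivariate_GCP P lam M ->
  (forall i, measurable_fun setT (G i t)) ->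
  independent2 P (sigma_processes M) (sigma_processes G) -> 0 <= t ->
  measurable [set w | forall i, M i (grid_up m (G i t w)) w = n i] /\
  P [set w | forall i, M i (grid_up m (G i t w)) w = n i] =
  (\sum_(l : {ffun 'I_q -> 'I_(m.+1 ^ 2).+1})
    (\prod_i gcp_pmf (@lam i) (n i) (grid_point m (l i)))%:E *
     P [set w | forall i, grid_level m (G i t w) = l i])%E.
Proof.
move=> hM mG hMG t0.
(* The vector of cells takes finitely many values, and on each of them the random times become fixed
   grid points. *)
pose X w : {ffun 'I_q -> 'I_(m.+1 ^ 2).+1} :=
  [ffun i => Ordinal (grid_level_lt m (G i t w))].
have XE l : [set w | X w = l] = [set w | forall i, grid_level m (G i t w) = l i].
  apply/seteqP; split => w /=; first by move=> <- i; rewrite ffunE.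
  by move=> h; apply/ffunP => i; apply/val_inj; rewrite ffunE/= h.
pose A (l : {ffun 'I_q -> 'I_(m.+1 ^ 2).+1}) :=
  [set w | forall i, M i (grid_point m (l i)) w = n i].
have AE l : [set w | forall i, M i (grid_up m (G i t w)) w = n i] `&`
    [set w | X w = l] =
    A l `&` [set w | forall i, grid_level m (G i t w) = l i].
  rewrite XE; apply/seteqP; split => w /= [h1 h2]; split => // i;
  by have := h1 i; rewrite /grid_up h2.
have mA l : measurable (A l).
  rewrite (_ : A l = \bigcap_(i in [set: 'I_q])
      [set w | M i (grid_point m (l i)) w = n i]).
    apply: fin_bigcap_measurable; first exact: finite_finset.
    move=> i _; apply: (levy_measurable_eq_nat _ (proj1 (proj1 hM i))).
    exact: grid_point_ge0.
  by apply/seteqP; split => w hw; [move=> o _; exact: hw|move=> o; exact: hw].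
have mL l : measurable [set w | forall i, grid_level m (G i t w) = l i].
  rewrite (_ : mkset _ = \bigcap_(i in [set: 'I_q])
      [set w | grid_level m (G i t w) = l i]).
    apply: fin_bigcap_measurable; first exact: finite_finset.
    move=> i _; rewrite -[X in measurable X]setTI.
    exact: (mG i measurableT _ (measurable_grid_level m (l i))).
  by apply/seteqP; split => w hw; [move=> o _; exact: hw|move=> o; exact: hw].
have mAL l : measurable ([set w | forall i, M i (grid_up m (G i t w)) w = n i] `&`
    [set w | X w = l]).
  by rewrite AE; exact: measurableI.
split.
  (* Although [M] is sampled at random times, the event is a finite union of events at fixed times,
     hence measurable. *)
  rewrite (_ : mkset _ = \bigcup_(l in [set: {ffun 'I_q -> 'I_(m.+1 ^ 2).+1}])
    ([set w | forall i, M i (grid_up m (G i t w)) w = n i] `&` [set w | X w = l])).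
    by apply: fin_bigcup_measurable => //; exact: finite_finset.
  apply/seteqP; split => w; first by move=> h; exists (X w).
  by move=> [l _ []].
rewrite (measure_fin_partition P (X := X))//; apply: eq_bigr => l _.
rewrite AE hMG.
- congr (_ * _)%E; apply: multivariate_GCP_joint => // i; exact: grid_point_ge0.
- apply: sigma_algebra_forall => i.
  exact: (@sigma_processes_preimage _ _ _ _ _ _ M i (grid_point m (l i)) [set n i]
    (grid_point_ge0 _ _)).
- apply: sigma_algebra_forall => i.
  exact: (@sigma_processes_preimage _ _ _ _ _ _ G i t _ t0
    (measurable_grid_level m (l i))).
Qed.

End freezing.

(** * The series formula for the discretized process *)

Section assembly.
Context {R : realType}.

Lemma pochhammer_ge0 (x : R) (k : nat) : 0 <= x -> 0 <= pochhammer x k.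
Proof. by move=> x0; apply: prodr_ge0 => i _; rewrite addr_ge0. Qed.

(** Read backwards, the falling product from [h + x - 1] is the rising product from [x]. *)
Lemma gbinomial_pochhammer (x : R) (h : nat) :
  gbinomial (h%:R + x - 1) h = pochhammer x h / h`!%:R.
Proof.
rewrite /gbinomial /pochhammer; congr (_ / _).
rewrite (reindex_inj rev_ord_inj)/=; apply: eq_bigr => i _.
by rewrite natrB ?ltn_ord// -[i.+1]addn1 natrD; ring.
Qed.

Lemma gcp_gamma_pmf_ge0 (k : nat) (lam : 'I_k -> R) (n : nat) (s a : R) :
  (forall j, 0 <= lam j) -> 0 <= s -> 0 <= a -> 0 <= gcp_gamma_pmf lam n s a.
Proof.
move=> lam0 s0 a0; rewrite /gcp_gamma_pmf mulr_ge0 ?powR_ge0// fsumr_ge0// => m _.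
rewrite mulr_ge0 ?pochhammer_ge0// prodr_ge0// => j _.
by rewrite divr_ge0// exprn_ge0// divr_ge0// addr_ge0// sumr_ge0.
Qed.

Context {d : measure_display} {Omega : measurableType d}.
Variable P : probability Omega R.

(** The cells partition the space, so the sum is an average of values in [[0, 1]]; this provides the
    domination of the series over [h]. *)
Lemma sum_grid_prob_bounds (Y : Omega -> R) (p : R -> R) (m : nat) :
  (forall l, measurable [set w | grid_level m (Y w) = l]) ->
  (forall x, 0 <= x -> 0 <= p x <= 1) ->
  0 <= \sum_(l < (m.+1 ^ 2).+1)
     p (grid_point m l) * fine (P [set w | grid_level m (Y w) = l]) <= 1.
Proof.
move=> mY p01; have pl l := p01 _ (grid_point_ge0 m l).
apply/andP; split.
  apply: sumr_ge0 => l _; have /andP[? _] := pl l.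
  by rewrite mulr_ge0// fine_ge0.
apply: (@le_trans _ _ (\sum_(l < (m.+1 ^ 2).+1)
    fine (P [set w | grid_level m (Y w) = l]))).
  apply: ler_sum => l _; have /andP[_ ?] := pl l.
  by rewrite ler_piMl// fine_ge0.
rewrite -lee_fin -sumEFin -(probability_setT P).
pose X w := Ordinal (grid_level_lt m (Y w)).
have XE l : setT `&` [set w | X w = l] = [set w | grid_level m (Y w) = l].
  rewrite setTI; apply/seteqP; split => w /=; first by move=> <-.
  by move=> h; apply/val_inj.
rewrite (measure_fin_partition P (X := X)); last by move=> l; rewrite XE.
by apply: lee_sum => l _; rewrite XE fineK// fin_num_measure.
Qed.

(** Inserts [multivariate_gamma_law] for the cell probabilities in [freeze_grid], then turns the sum
    over vectors of cells into a product of sums over single cells. *)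
Lemma time_changed_grid (q : nat) (k : 'I_q -> nat) (lam : forall i, 'I_(k i) -> R)
    (hlam : forall i j, 0 < lam i j) (lambda theta : R) (hlambda : 0 < lambda)
    (a : 'I_q -> R)
    (M : 'I_q -> R -> Omega -> nat) (hM : multivariate_GCP P lam M)
    (Z : 'I_q -> R -> Omega -> R) (B : R -> Omega -> nat)
    (G : 'I_q -> R -> Omega -> R)
    (hG : multivariate_gamma_subordinator P lambda theta a Z B G)
    (hMG : independent2 P (sigma_processes M) (sigma_processes G))
    (n : 'I_q -> nat) (t : R) (ht : 0 <= t) (m : nat) :
  measurable [set w | forall i, M i (grid_up m (G i t w)) w = n i] /\
  P [set w | forall i, M i (grid_up m (G i t w)) w = n i] =
  (\sum_(0 <= h <oo) (fine (P [set w | B (lambda * t) w = h]) *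
    \prod_i \sum_(l < (m.+1 ^ 2).+1) gcp_pmf (@lam i) (n i) (grid_point m l) *
      fine (P [set w | grid_level m (Z i (t + lambda^-1 * h%:R) w) = l]))%:E)%E.
Proof.
have p0 i l : 0 <= gcp_pmf (@lam i) (n i) (grid_point m l).
  by apply: gcp_pmf_ge0 => [j|]; [exact/ltW/hlam|exact: grid_point_ge0].
have mG i : measurable_fun setT (G i t).
  have [hZ hB _ hGZ] := hG.
  (* Splitting on the countably many values of [B] replaces the random time of [Z i] by fixed
     ones. *)
  move=> _ A mA; rewrite (_ : _ `&` _ =
    \bigcup_h ([set w | A (Z i (t + lambda^-1 * h%:R) w)] `&`
      [set w | B (lambda * t) w = h])).
    apply: bigcup_measurable => h _; apply: measurableI.
      apply: (levy_measurable_preimage (proj1 (hZ i))) mA.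
      by rewrite addr_ge0// mulr_ge0// invr_ge0 ltW.
    exact: (levy_measurable_eq_nat h (proj1 hB) ht).
  rewrite setTI; apply/seteqP; split => w /=.
    by rewrite hGZ// => Aw; exists (B (lambda * t) w).
  by move=> [h _ [/= Aw Bw]]; rewrite hGZ// Bw.
have [mE ->] := freeze_grid n m hM mG hMG ht; split=> //.
pose b h := fine (P [set w | B (lambda * t) w = h]).
pose r i h l := fine (P [set w | grid_level m (Z i (t + lambda^-1 * h%:R) w) = l]).
have r0 i h l : 0 <= r i h l by exact: fine_ge0.
have b0 h : 0 <= b h by exact: fine_ge0.
transitivity (\sum_(l : {ffun 'I_q -> 'I_(m.+1 ^ 2).+1}) \sum_(0 <= h <oo)
   (\prod_i gcp_pmf (@lam i) (n i) (grid_point m (l i)) * (b h *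
    \prod_i r i h (l i)))%:E)%E.
  apply: eq_bigr => l _.
  rewrite (multivariate_gamma_law (C := fun i => [set x | grid_level m x = l i])
    hlambda hG ht); last by move=> i; exact: measurable_grid_level.
  rewrite -nneseriesZl; last first.
    move=> h _; rewrite lee_fin mulr_ge0 ?fine_ge0// prodr_ge0// => i _.
    exact: fine_ge0.
  by apply: eq_eseriesr => h _; rewrite -EFinM.
rewrite -nneseries_sum; last first.
  move=> l h _; rewrite lee_fin; apply: mulr_ge0; first exact: prodr_ge0.
  by apply: mulr_ge0 => //; exact: prodr_ge0.
apply: eq_eseriesr => h _; rewrite sumEFin; congr EFin.
(* Distributivity: a sum over functions [l] of products over [i] is a product over [i] of sums. *)
rewrite bigA_distr_bigA big_distrr/=; apply: eq_bigr => l _.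
by rewrite mulrCA -big_split.
Qed.
End assembly.

(** * State probabilities of the time-changed process *)

Theorem theorem4p2 (R : realType) (d : measure_display)
    (Omega : measurableType d) (P : probability Omega R)
    (q : nat) (hq : (0 < q)%N)
    (k : 'I_q -> nat) (hk : forall i, (0 < k i)%N)
    (lam : forall i, 'I_(k i) -> R) (hlam : forall i j, 0 < lam i j)
    (lambda theta : R) (hlambda : 0 < lambda) (htheta : 0 < theta < 1)
    (a : 'I_q -> R) (ha : forall i, 0 < a i)
    (M : 'I_q -> R -> Omega -> nat) (hM : multivariate_GCP P lam M)
    (Z : 'I_q -> R -> Omega -> R) (B : R -> Omega -> nat)
    (G : 'I_q -> R -> Omega -> R)
    (hG : multivariate_gamma_subordinator P lambda theta a Z B G)
    (hMG : independent2 P (sigma_processes M) (sigma_processes G))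
    (MM : 'I_q -> R -> Omega -> nat) (hMM : time_changed P M G MM)
    (n : 'I_q -> nat) (t : R) (ht : 0 <= t) :
  let lamsum i := \sum_(j < k i) lam i j in
  P [set w | forall i, MM i t w = n i] =
  (((1 - theta) `^ (lambda * t))%:E *
   \sum_(0 <= h <oo)
     (theta ^+ h / h`!%:R * pochhammer (lambda * t) h *
      \prod_(i < q)
        ((a i / (a i + lamsum i)) `^ (h%:R + lambda * t) *
         \sum_(m \in jump_counts (k i) (n i))
           (pochhammer (h%:R + lambda * t) (\sum_(j < k i) m j)%N *
            \prod_(j < k i)
              ((lam i j / (a i + lamsum i)) ^+ m j / (m j)`!%:R))))%:E)%E.
Proof.
have [hZ hB _ hGZ] := hG.
have /andP[th0 th1] := htheta.
(* Where [B (lambda * t)] equals [h], the [Z i] are evaluated at time [u h], with shape parameter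
   [s h = lambda * u h]. *)
pose u h := t + lambda^-1 * h%:R.
have u0 h : 0 <= u h by rewrite addr_ge0// mulr_ge0// invr_ge0 ltW.
pose s h := h%:R + lambda * t.
have s0 h : 0 <= s h by rewrite addr_ge0// mulr_ge0// ltW.
have us h : lambda * u h = s h.
  by rewrite /u /s mulrDr mulrA mulfV ?gt_eqF// mul1r addrC.
have lam0 i j : 0 <= lam i j by exact/ltW/hlam.
pose b h := fine (P [set w | B (lambda * t) w = h]).
have bE h : b h = (1 - theta) `^ (lambda * t) *
    (theta ^+ h / h`!%:R * pochhammer (lambda * t) h).
  have /= := proj2 hB t h ht.
  by rewrite /b => ->/=; rewrite gbinomial_pochhammer; ring.
(* Absorbing the prefactor into the weights [b h] turns the target into a mixture over the values of
   [B]. *)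
transitivity (\sum_(0 <= h <oo)
    (b h * \prod_i gcp_gamma_pmf (@lam i) (n i) (s h) (a i))%:E)%E; last first.
  rewrite -nneseriesZl; last first.
    move=> h _; rewrite lee_fin mulr_ge0//.
      apply: mulr_ge0; first by rewrite divr_ge0// exprn_ge0// ltW.
      by rewrite pochhammer_ge0// mulr_ge0// ltW.
    apply: prodr_ge0 => i _; 
    exact: (@gcp_gamma_pmf_ge0 _ _ (@lam i) (n i) _ _ (lam0 i) (s0 h) (ltW (ha i))).
  by apply: eq_eseriesr => h _; rewrite -EFinM bE; congr EFin; rewrite -[LHS]mulrA.
have p01 i x : 0 <= x -> 0 <= gcp_pmf (@lam i) (n i) x <= 1.
  move=> x0; rewrite gcp_pmf_ge0//=.
  rewrite -lee_fin -(gcp_pmf_prob _ (proj1 hM i))// probability_le1//.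
  exact: (levy_measurable_eq_nat _ (proj1 (proj1 hM i))).
pose E_ m := [set w | forall i, M i (grid_up m (G i t w)) w = n i].
pose c m h := \prod_i \sum_(l < (m.+1 ^ 2).+1)
  gcp_pmf (@lam i) (n i) (grid_point m l) *
      fine (P [set w | grid_level m (Z i (u h) w) = l]).
have grid m := time_changed_grid hlam hlambda hM hG hMG n ht m.
have lim1 : P (E_ m) @[m --> \oo] --> P [set w | forall i, MM i t w = n i].
  apply: cvg_measure_ae.
  - by move=> m; have [] := grid m.
  - rewrite (_ : mkset _ = \bigcap_(i in [set: 'I_q]) [set w | MM i t w = n i]).
      apply: fin_bigcap_measurable; first exact: finite_finset.
      move=> i _; rewrite -[X in measurable X]setTI.
      exact: (proj1 (hMM i t ht) measurableT [set n i]).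
    by apply/seteqP; split => w hw; [move=> o _; exact: hw|move=> o; exact: hw].
  (* [G i t] is one of the countably many variables [Z i (u h)], so their null sets can be discarded
     together. *)
  have aeG i : {ae P, forall w, 0 <= G i t w}.
    have : {ae P, forall w, forall h, 0 <= Z i (u h) w}.
      by apply: ae_foralln => j; exact: (gamma_process_ge0 (hZ i) (u0 j)).
    by apply: filterS => w hw; rewrite hGZ//; exact: hw.
  have : {ae P, forall w, forall i, [/\ 0 <= G i t w,
      cadlag (fun t => (M i t w)%:R : R) & MM i t w = M i (G i t w) w]}.
    apply: filter_forall => i.
    apply: filterS3 (aeG i) (levy_cadlag (proj1 (proj1 hM i))) (proj2 (hMM i t ht)).
    by move=> w *; split.
  apply: filterS => w hw.
  (* Right-continuity gives convergence along the grid times; for integer values this is eventual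
     equality, at once for the finitely many [i]. *)
  have : \forall m \near \oo, forall i, M i (grid_up m (G i t w)) w = M i (G i t w) w.
    apply: filter_forall => i; have [g0 [rc _] _] := hw i.
    apply: cvg_nat_near.
    exact: (cvg_comp _ _ (cvg_grid_up g0) (rc _ g0)).
  apply: filterS => m hm; split => hn j; have [_ _ e] := hw j.
    by rewrite e -hm hn.
  by rewrite hm -e hn.
(* By uniqueness of limits it remains to find the limit of the same probabilities written as
   series. *)
rewrite -(cvg_lim _ lim1)//; apply/cvg_lim => //.
rewrite (eq_cvg _ _ (fun m => proj2 (grid m))).
apply: (cvg_nneseries_dominated (c := c)).
- by move=> h; exact: fine_ge0.
(* The weights sum to 1, being the probabilities of a partition by the values of [B]. *)
- rewrite (_ : (\sum_(0 <= h <oo) (b h)%:E)%E = P setT) ?probability_setT ?ltry//.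
  rewrite -(probability_setT P).
  rewrite (@measure_nat_partition _ _ _ P (B (lambda * t)) setT); last first.
    by move=> h; rewrite setTI; exact: (levy_measurable_eq_nat h (proj1 hB) ht).
  apply: eq_eseriesr => h _; rewrite setTI fineK// fin_num_measure//.
  exact: (levy_measurable_eq_nat h (proj1 hB) ht).
- move=> m h.
  have cb i := @sum_grid_prob_bounds _ _ _ P (Z i (u h)) _ m
    (fun l => levy_measurable_preimage (proj1 (hZ i)) (u0 h) (measurable_grid_level m l))
    (p01 i).
  rewrite prodr_ge0 => [|i _]; last by case/andP: (cb i).
  by apply: prodr_ile1 => i _; exact: cb.
- move=> h; apply: cvg_big => [|i _]; first exact: mul_continuous.
  apply: (cvg_sum_grid_gamma_process (hZ i) (u0 h)).
  + exact: continuous_gcp_pmf.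
  + exact: p01.
  + move=> uh0; rewrite us; apply: integral_gcp_pmf_gamma_density => //.
      by rewrite -us mulr_gt0.
    by rewrite -us; exact: (gamma_process_total (hZ i)).
  (* This happens only for [t = 0] and [h = 0], where the shape is 0. *)
  + by move=> uh0; rewrite -us uh0 mulr0 gcp_gamma_pmf0.
Qed.
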